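(* Let $A_1,\dots,A_m\in\mathbb{R}^{n\times n}$, $Z\in\mathbb{R}^{n\times n}$ and $\delta\ge 0$ satisfy $\sum_{i=1}^m\|A_iZ-Z^TA_i\|_F^2\le\delta^2\|Z\|_F^2$. Let $\tau_n=(n_1,\dots,n_s)$, $s\ge 2$, be a partition of $n$, and suppose $Z$ has an eigenvalue decomposition $$Z=WGW^{-1}=W\,\mathrm{diag}(G_1,\dots,G_s)\,W^{-1},$$ where $W\in\mathbb{R}^{n\times n}$ is nonsingular, $G_j\in\mathbb{R}^{n_j\times n_j}$ for $j=1,\dots,s$, $\lambda(G_j)\cap\lambda(G_k)=\emptyset$ for $j\neq k$, and $W$ satisfies $\mathrm{Bdiag}_{\tau_n}(W^TW)=I_n$. Then $$f(\tau_n,W)\le\frac{\delta^2\|Z\|_F^2\|W\|_2^4}{\mathrm{sep}(G)^2},$$ where $f(\tau_n,W)=\sum_{i=1}^m\|\mathrm{OffBdiag}_{\tau_n}(W^TA_iW)\|_F^2$, $\mathrm{sep}(G)=\min_{j\ne k}\mathrm{sep}(G_j^T,G_k)$, and $\mathrm{sep}(G_j^T,G_k)=\min_{X\neq 0}\frac{\|G_j^TX-XG_k\|_F}{\|X\|_F}$ (the minimum over nonzero $X\in\mathbb{R}^{n_j\times n_k}$).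
   Context: A partition of $n$ is a tuple of positive integers with sum $n$. For a partition $\tau_n=(n_1,\dots,n_s)$ and a matrix $A$ of order $n$ partitioned conformally as $[A_{jk}]$ with $A_{jk}$ of size $n_j\times n_k$, $\mathrm{Bdiag}_{\tau_n}(A)=\mathrm{diag}(A_{11},\dots,A_{ss})$ and $\mathrm{OffBdiag}_{\tau_n}(A)=A-\mathrm{Bdiag}_{\tau_n}(A)$. $\lambda(\cdot)$ denotes the set of eigenvalues of a square matrix; $\|\cdot\|_2$ and $\|\cdot\|_F$ are the spectral and Frobenius norms. *)

(* Defs.v *)
From HB Require Import structures.
From mathcomp Require Import all_boot all_order all_algebra.
From mathcomp Require Import complex.
From mathcomp Require Import classical_sets reals.

Set Implicit Arguments.
Unset Strict Implicit.
Unset Printing Implicit Defensive.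

Import Order.TTheory GRing.Theory Num.Theory.

Local Open Scope classical_set_scope.
Local Open Scope ring_scope.

(* For a column vector this is the Euclidean norm.  (The norm that
   MathComp-Analysis puts on matrices is the entrywise maximum.) *)
Definition frobenius_norm (R : realType) (m n : nat) (A : 'M[R]_(m, n)) : R :=
  Num.sqrt (\sum_(i < m) \sum_(j < n) A i j ^+ 2).

(* The set of quotients is bounded, and nonempty as soon as 0 < n; for n = 0
   the value is sup set0 = 0. *)
Definition spectral_norm (R : realType) (m n : nat) (A : 'M[R]_(m, n)) : R :=
  sup [set frobenius_norm (A *m x) / frobenius_norm x
      | x in [set x : 'cV[R]_n | x != 0]].

(* The eigenvalues of a real matrix are the complex ones. *)
Definition spectrum (R : realType) (n : nat) (A : 'M[R]_n) : set R[i] :=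
  [set a | eigenvalue (map_mx (real_complex R) A) a].

(* A partition tau_n = (n_1, ..., n_s) of n is given by tau : 'I_s -> nat with
   positive values, the order n being the sum of the tau j, as for the block
   matrices of the library. *)
Definition Bdiag (R : realType) (s : nat) (tau : 'I_s -> nat)
    (A : 'M[R]_(\sum_(j < s) tau j)) : 'M[R]_(\sum_(j < s) tau j) :=
  \mxdiag_(j < s) submxblock A j j.

Definition OffBdiag (R : realType) (s : nat) (tau : 'I_s -> nat)
    (A : 'M[R]_(\sum_(j < s) tau j)) : 'M[R]_(\sum_(j < s) tau j) :=
  A - Bdiag A.

(* sep2 A B is sep(A, B) = min_(X != 0) |A X - X B|_F / |X|_F.  The minimum is
   attained when 0 < p and 0 < q (the quotient is continuous and homogeneous of
   degree 0, and the unit sphere is compact), hence equal to the infimum. *)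
Definition sep2 (R : realType) (p q : nat) (A : 'M[R]_p) (B : 'M[R]_q) : R :=
  inf [set frobenius_norm (A *m X - X *m B) / frobenius_norm X
      | X in [set X : 'M[R]_(p, q) | X != 0]].

(* The infimum of a finite set, nonempty when 1 < s, hence its minimum. *)
Definition sep (R : realType) (s : nat) (tau : 'I_s -> nat)
    (G : forall j : 'I_s, 'M[R]_(tau j)) : R :=
  inf [set sep2 (G jk.1)^T (G jk.2)
      | jk in [set jk : 'I_s * 'I_s | jk.1 != jk.2]].

Definition offdiag_cost (R : realType) (m s : nat) (tau : 'I_s -> nat)
    (A : 'I_m -> 'M[R]_(\sum_(j < s) tau j))
    (W : 'M[R]_(\sum_(j < s) tau j)) : R :=
  \sum_(i < m) frobenius_norm (OffBdiag (W^T *m A i *m W)) ^+ 2.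

(* Main.v *)
(* With B_i = W^T A_i W, the congruence by W turns A_i Z - Z^T A_i into
   B_i G - G^T B_i, whose (j, k) block is B_jk G_k - G_j^T B_jk.  Its norm is at
   least sep(G) |B_jk|_F when j <> k, while the congruence multiplies the
   Frobenius norm by at most |W|_2^2.  Since the quotient by sep(G)^2 is
   meaningful only if sep(G) > 0, one also needs the Sylvester operators
   X |-> G_j^T X - X G_k to be injective; an injective linear map has a bounded
   left inverse, hence is bounded below. *)

Require Import Defs.
From HB Require Import structures.
From mathcomp Require Import all_boot all_order all_algebra.
From mathcomp Require Import complex.
From mathcomp Require Import classical_sets reals.
From mathcomp Require Import boolp ring.

Set Implicit Arguments.
Unset Strict Implicit.
Unset Printing Implicit Defensive.

Import Order.TTheory GRing.Theory Num.Theory.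

Local Open Scope classical_set_scope.
Local Open Scope ring_scope.

(** * Signs of infima and suprema; the Cauchy-Schwarz inequality *)

Lemma inf_ge0 (R : realType) (E : set R) :
  (forall x, E x -> 0 <= x) -> 0 <= inf E.
Proof.
move=> E0; have [->|/set0P E_neq0] := eqVneq E set0; first by rewrite inf0.
exact: lb_le_inf.
Qed.

Lemma sup_ge0 (R : realType) (E : set R) :
  (forall x, E x -> 0 <= x) -> 0 <= sup E.
Proof.
(* A set that is empty or unbounded above has the default [sup] 0. *)
move=> E0; have [[[x Ex] Eub]|/sup_out-> //] := pselect (has_sup E).
exact: le_trans (E0 x Ex) (ub_le_sup Eub Ex).
Qed.

(** Lagrange's identity: twice the defect of the inequality is the sum of the squares of all the
    minors [a i * b j - a j * b i]. *)
Lemma cauchy_schwarz_sum (R : realDomainType) (I : finType) (a b : I -> R) :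
  (\sum_i a i * b i) ^+ 2 <= (\sum_i a i ^+ 2) * (\sum_i b i ^+ 2).
Proof.
have lagrange : 0 <= \sum_i \sum_j (a i * b j - a j * b i) ^+ 2.
  by apply: sumr_ge0 => i _; apply: sumr_ge0 => j _; exact: sqr_ge0.
suff E : \sum_i \sum_j (a i * b j - a j * b i) ^+ 2 =
    ((\sum_i a i ^+ 2) * (\sum_i b i ^+ 2) - (\sum_i a i * b i) ^+ 2) *+ 2.
  by rewrite E pmulrn_lge0 // subr_ge0 in lagrange.
have dist (f g : I -> R) :
    (\sum_i f i) * (\sum_i g i) = \sum_i \sum_j f i * g j.
  by rewrite mulr_suml; apply: eq_bigr => i _; rewrite mulr_sumr.
rewrite mulrnBl mulr2n {2}[_ * (\sum_i b i ^+ 2)]mulrC expr2 !dist -sumrMnl.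
rewrite -big_split -sumrB; apply: eq_bigr => i _ /=.
rewrite -sumrMnl -big_split -sumrB; apply: eq_bigr => j _ /=; ring.
Qed.

(** * Frobenius and spectral norms *)

Section FrobeniusNorm.
Variable R : realType.

Lemma frobenius_norm_ge0 m n (A : 'M[R]_(m, n)) : 0 <= frobenius_norm A.
Proof. exact: sqrtr_ge0. Qed.

Lemma sqr_frobenius_norm m n (A : 'M[R]_(m, n)) :
  frobenius_norm A ^+ 2 = \sum_(i < m) \sum_(j < n) A i j ^+ 2.
Proof.
rewrite sqr_sqrtr //; apply: sumr_ge0 => i _.
by apply: sumr_ge0 => j _; exact: sqr_ge0.
Qed.

Lemma frobenius_norm_eq0 m n (A : 'M[R]_(m, n)) :
  (frobenius_norm A == 0) = (A == 0).
Proof.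
rewrite -sqrf_eq0 sqr_frobenius_norm psumr_eq0; last first.
  by move=> i _; apply: sumr_ge0 => j _; exact: sqr_ge0.
apply/allP/eqP => [A0|-> i _]; last first.
  by apply/implyP => _; rewrite big1 // => j _; rewrite mxE expr0n.
apply/matrixP => i j; have := A0 i (mem_index_enum i).
rewrite /= psumr_eq0 => [/allP/(_ j (mem_index_enum j))|k _]; last exact: sqr_ge0.
by rewrite /= sqrf_eq0 mxE => /eqP.
Qed.

Lemma frobenius_norm0 m n : frobenius_norm (0 : 'M[R]_(m, n)) = 0.
Proof. by apply/eqP; rewrite frobenius_norm_eq0. Qed.

Lemma frobenius_norm_gt0 m n (A : 'M[R]_(m, n)) :
  (0 < frobenius_norm A) = (A != 0).
Proof. by rewrite lt0r frobenius_norm_eq0 frobenius_norm_ge0 andbT. Qed.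

Lemma frobenius_norm_tr m n (A : 'M[R]_(m, n)) :
  frobenius_norm A^T = frobenius_norm A.
Proof.
congr Num.sqrt; rewrite exchange_big /=.
by apply: eq_bigr => i _; apply: eq_bigr => j _; rewrite mxE.
Qed.

Lemma frobenius_normN m n (A : 'M[R]_(m, n)) :
  frobenius_norm (- A) = frobenius_norm A.
Proof.
congr Num.sqrt.
by apply: eq_bigr => i _; apply: eq_bigr => j _; rewrite mxE sqrrN.
Qed.

Lemma frobenius_norm_mxvec m n (A : 'M[R]_(m, n)) :
  frobenius_norm (mxvec A) = frobenius_norm A.
Proof.
congr Num.sqrt; rewrite big_ord1 pair_bigA /=.
rewrite (reindex _ (curry_mxvec_bij m n)) /=.
by apply: eq_bigr => -[i j] _ /=; rewrite mxvecE.
Qed.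

Lemma frobenius_normM m n p (A : 'M[R]_(m, n)) (B : 'M[R]_(n, p)) :
  frobenius_norm (A *m B) <= frobenius_norm A * frobenius_norm B.
Proof.
rewrite -ler_sqr ?nnegrE ?mulr_ge0 ?frobenius_norm_ge0 // exprMn.
rewrite !sqr_frobenius_norm mulr_suml; apply: ler_sum => i _.
rewrite [X in _ <= _ * X]exchange_big mulr_sumr.
by apply: ler_sum => j _; rewrite mxE; exact: cauchy_schwarz_sum.
Qed.

Lemma sqr_frobenius_norm_cols m n (A : 'M[R]_(m, n)) :
  frobenius_norm A ^+ 2 = \sum_(j < n) frobenius_norm (col j A) ^+ 2.
Proof.
rewrite sqr_frobenius_norm exchange_big /=; apply: eq_bigr => j _.
by rewrite sqr_frobenius_norm; apply: eq_bigr => i _; rewrite big_ord1 mxE.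
Qed.

Lemma sqr_frobenius_norm_cV n (x : 'cV[R]_n) :
  frobenius_norm x ^+ 2 = (x^T *m x) 0 0.
Proof.
rewrite sqr_frobenius_norm mxE; apply: eq_bigr => i _.
by rewrite big_ord1 mxE expr2.
Qed.

Lemma sqr_frobenius_norm_blocks s (tau : 'I_s -> nat)
    (A : 'M[R]_(\sum_(j < s) tau j)) :
  frobenius_norm A ^+ 2 =
    \sum_(j < s) \sum_(k < s) frobenius_norm (submxblock A j k) ^+ 2.
Proof.
rewrite sqr_frobenius_norm.
under [RHS]eq_bigr do under eq_bigr do rewrite sqr_frobenius_norm.
under [RHS]eq_bigr do rewrite exchange_big.
(* The sums are now grouped as (block, position) pairs, for rows and then for columns; [tagnat]
   matches such pairs with the flat indices. *)
rewrite [RHS]sig_big_dep (reindex _ tagnat.sig_bij_on) /=.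
apply: eq_bigr => u _; rewrite [RHS]sig_big_dep.
rewrite (reindex _ tagnat.sig_bij_on) /=.
by apply: eq_bigr => v _; rewrite !mxE !tagnat.sig2K.
Qed.

Lemma frobenius_norm_mulV m n (W : 'M[R]_(m, n)) (x : 'cV[R]_n) :
  frobenius_norm (W *m x) <= spectral_norm W * frobenius_norm x.
Proof.
have [->|x0] := eqVneq x 0.
  by rewrite mulmx0 !frobenius_norm0 mulr0.
rewrite -ler_pdivrMr ?frobenius_norm_gt0 //.
apply: ub_le_sup; last by exists x.
(* The Frobenius norm of [W] bounds all the quotients, so that [sup] is a true supremum. *)
exists (frobenius_norm W) => _ [y /= y0 <-].
by rewrite ler_pdivrMr ?frobenius_norm_gt0 // frobenius_normM.
Qed.

Lemma spectral_norm_ge0 m n (W : 'M[R]_(m, n)) : 0 <= spectral_norm W.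
Proof.
apply: sup_ge0 => _ [x _ <-].
by rewrite divr_ge0 ?frobenius_norm_ge0.
Qed.

(* [|W^T x|^2 = <W W^T x, x> <= ||W|| |W^T x| |x|], whence [||W^T|| <= ||W||]. *)
Lemma frobenius_norm_trmulV m n (W : 'M[R]_(m, n)) (x : 'cV[R]_m) :
  frobenius_norm (W^T *m x) <= spectral_norm W * frobenius_norm x.
Proof.
have [y0|] := eqVneq (W^T *m x) 0.
  rewrite y0 frobenius_norm0.
  by rewrite mulr_ge0 ?spectral_norm_ge0 ?frobenius_norm_ge0.
set y := W^T *m x => y0.
have yn : 0 < frobenius_norm y by rewrite frobenius_norm_gt0.
rewrite -(ler_pM2l yn) -expr2 sqr_frobenius_norm_cV.
have -> : y^T *m y = (W *m y)^T *m x.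
  by rewrite /y !trmx_mul trmxK !mulmxA.
have le11 (B : 'M[R]_1) : B 0 0 <= frobenius_norm B.
  by rewrite /frobenius_norm !big_ord1 sqrtr_sqr ler_norm.
apply: le_trans (le11 _) _; apply: le_trans (frobenius_normM _ _) _.
rewrite frobenius_norm_tr mulrA ler_wpM2r ?frobenius_norm_ge0 //.
by rewrite mulrC; exact: frobenius_norm_mulV.
Qed.

Lemma frobenius_norm_trmulM m n p (W : 'M[R]_(m, n)) (C : 'M[R]_(m, p)) :
  frobenius_norm (W^T *m C) <= spectral_norm W * frobenius_norm C.
Proof.
rewrite -ler_sqr ?nnegrE ?mulr_ge0 ?spectral_norm_ge0 ?frobenius_norm_ge0 //.
rewrite exprMn !sqr_frobenius_norm_cols mulr_sumr; apply: ler_sum => j _.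
rewrite -exprMn !colE -mulmxA ler_sqr ?nnegrE ?mulr_ge0 ?spectral_norm_ge0 //;
  [exact: frobenius_norm_trmulV|exact: frobenius_norm_ge0..].
Qed.

Lemma frobenius_norm_congruence m n (W : 'M[R]_(m, n)) (C : 'M[R]_m) :
  frobenius_norm (W^T *m C *m W) <= spectral_norm W ^+ 2 * frobenius_norm C.
Proof.
rewrite -mulmxA expr2 -mulrA; apply: le_trans (frobenius_norm_trmulM _ _) _.
(* Transposition turns the right factor [W] into a left factor [W^T], and the same bound applies a
   second time. *)
rewrite ler_wpM2l ?spectral_norm_ge0 // -[C *m W]trmxK frobenius_norm_tr.
rewrite trmx_mul -(frobenius_norm_tr C); exact: frobenius_norm_trmulM.
Qed.

End FrobeniusNorm.

(** * Sylvester operators: injectivity and lower bounds *)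

Section Sylvester.
Variable R : realType.

(** Coprimality can be tested over [R[i]], which is algebraically closed: a nonconstant gcd would
    have a root there, a common eigenvalue. *)
Lemma coprimep_char_poly p q (A : 'M[R]_p) (B : 'M[R]_q) :
  spectrum A `&` spectrum B = set0 -> coprimep (char_poly A) (char_poly B).
Proof.
move=> disj; rewrite -(coprimep_map (real_complex R)) !map_char_poly.
rewrite /coprimep; apply: contraT => /closed_rootP[a].
rewrite root_gcd -!eigenvalue_root_char => /andP[Aa Ba].
by have : (spectrum A `&` spectrum B) a by []; rewrite disj.
Qed.

(* If [A^T X = X B] then [char_poly A] applied to [B], which is invertible,
   annihilates [X]. *)
Lemma sylvester_inj p q (A : 'M[R]_p) (B : 'M[R]_q) (X : 'M[R]_(p, q)) :
  spectrum A `&` spectrum B = set0 -> A^T *m X = X *m B -> X = 0.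
Proof.
case: p A X => [|p] A X; first by move=> *; rewrite [X]flatmx0.
case: q B X => [|q] B X; first by move=> *; rewrite [X]thinmx0.
move=> /coprimep_char_poly; rewrite coprimep_sym.
move=> /Bezout_eq1_coprimepP[[u v] /= uv] AXB.
have comm f : horner_mx A^T f *m X = X *m horner_mx B f.
  elim/poly_ind: f => [|f c IH]; first by rewrite !rmorph0 mul0mx mulmx0.
  rewrite !rmorphD !rmorphM /= !horner_mx_X !horner_mx_C mulmxDl mulmxDr.
  rewrite -scalar_mxC; congr (_ + _).
  rewrite -[_ * A^T]/(_ *m A^T) -[_ * B]/(_ *m B).
  by rewrite -[LHS]mulmxA AXB [LHS]mulmxA IH -mulmxA.
have trA : char_poly A^T = char_poly A.
  rewrite /char_poly -det_tr; congr (\det _).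
  by rewrite /char_poly_mx linearB /= tr_scalar_mx map_trmx trmxK.
(* Evaluate the Bezout identity. Moved to the left of [X], at [A^T], the [char_poly A] term dies by
   Cayley-Hamilton; what remains, moved back to [B], dies in the same way. *)
have : X *m horner_mx B (u * char_poly B + v * char_poly A) = X.
  by rewrite uv rmorph1 mulmx1.
rewrite -comm rmorphD !rmorphM /= -trA.
rewrite [horner_mx A^T (char_poly A^T)]Cayley_Hamilton mulr0 addr0 -rmorphM comm.
by rewrite rmorphM /= Cayley_Hamilton mulr0 mulmx0 => <-.
Qed.

Lemma injective_linear_bounded_below m n p q
    (f : {linear 'M[R]_(m, n) -> 'M[R]_(p, q)}) :
  (forall X, f X = 0 -> X = 0) ->
  exists2 c : R, 0 < c & forall X, c * frobenius_norm X <= frobenius_norm (f X).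
Proof.
move=> f_inj; pose M := lin_mx f.
have Mfree : row_free M.
  rewrite -kermx_eq0; apply/eqP/row_matrixP => i; rewrite row0.
  have /f_inj : f (vec_mx (row i (kermx M))) = 0.
    apply: (can_inj mxvecK).
    by rewrite -mul_vec_lin vec_mxK linear0 -row_mul mulmx_ker row0.
  by move/(congr1 mxvec); rewrite vec_mxK linear0.
pose N := pinvmx M.
have fK X : mxvec X = mxvec (f X) *m N by rewrite -mul_vec_lin mulmxKp.
(* Adding 1 keeps the constant invertible even when [N] is zero, as happens in dimension 0. *)
have N1 : 0 < frobenius_norm N + 1 by rewrite ltr_wpDl ?frobenius_norm_ge0.
exists (frobenius_norm N + 1)^-1; first by rewrite invr_gt0.
move=> X; rewrite mulrC ler_pdivrMr // -frobenius_norm_mxvec fK.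
apply: le_trans (frobenius_normM _ _) _; rewrite frobenius_norm_mxvec.
by rewrite ler_wpM2l ?frobenius_norm_ge0 // lerDl.
Qed.

(** * Separation of two matrices and of a family *)

Lemma sep2_ge0 p q (A : 'M[R]_p) (B : 'M[R]_q) : 0 <= sep2 A B.
Proof.
apply: inf_ge0 => _ [X _ <-].
by rewrite divr_ge0 ?frobenius_norm_ge0.
Qed.

Lemma sep2_le p q (A : 'M[R]_p) (B : 'M[R]_q) (X : 'M[R]_(p, q)) :
  sep2 A B * frobenius_norm X <= frobenius_norm (A *m X - X *m B).
Proof.
have [->|X0] := eqVneq X 0.
  by rewrite mulmx0 mul0mx subr0 !frobenius_norm0 mulr0.
rewrite -ler_pdivlMr ?frobenius_norm_gt0 //.
apply: ge_inf; last by exists X.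
by exists 0 => _ [Y _ <-]; rewrite divr_ge0 ?frobenius_norm_ge0.
Qed.

(* Without [0 < p] and [0 < q] the infimum would be [inf set0 = 0]. *)
Lemma sep2_tr_gt0 p q (A : 'M[R]_p) (B : 'M[R]_q) :
  (0 < p)%N -> (0 < q)%N -> spectrum A `&` spectrum B = set0 ->
  0 < sep2 A^T B.
Proof.
case: p A => // p A; case: q B => // q B _ _ disj.
have [|c c0 cX] :=
  @injective_linear_bounded_below _ _ _ _ (mulmx A^T \- mulmxr B).
  by move=> X /= /eqP; rewrite subr_eq0 => /eqP; exact: sylvester_inj.
apply: lt_le_trans c0 _; apply: lb_le_inf.
  apply: image_nonempty; exists (const_mx 1) => /=; apply/eqP => /matrixP/(_ 0 0)/eqP.
  by rewrite !mxE oner_eq0.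
by move=> _ [X /= X0 <-]; rewrite ler_pdivlMr ?frobenius_norm_gt0 ?cX.
Qed.

Lemma sep_le_sep2 s (tau : 'I_s -> nat)
    (G : forall j : 'I_s, 'M[R]_(tau j)) j k :
  j != k -> sep G <= sep2 (G j)^T (G k).
Proof.
move=> jk; apply: ge_inf; last by exists (j, k).
by exists 0 => _ [u _ <-]; exact: sep2_ge0.
Qed.

Lemma sep_gt0 s (tau : 'I_s -> nat) (G : forall j : 'I_s, 'M[R]_(tau j)) :
  (1 < s)%N -> (forall j k, j != k -> 0 < sep2 (G j)^T (G k)) -> 0 < sep G.
Proof.
move=> s1 G0.
(* A minimum of finitely many positive numbers is positive; the seed 1 only has to be positive too,
   as [c] serves as a lower bound. *)
pose c := \big[Num.min/(1 : R)]_(u : 'I_s * 'I_s | u.1 != u.2)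
  sep2 (G u.1)^T (G u.2).
have c0 : 0 < c by apply: lt_bigmin => // u; exact: G0.
apply: lt_le_trans c0 _; apply: lb_le_inf.
  pose u := (Ordinal (ltnW s1), Ordinal s1).
  by exists (sep2 (G u.1)^T (G u.2)); exists u.
by move=> _ [u /= u12 <-]; exact: bigmin_le_cond.
Qed.

(** * Passage to blocks *)

Lemma submxblock_OffBdiag s (tau : 'I_s -> nat)
    (B : 'M[R]_(\sum_(j < s) tau j)) j k :
  submxblock (OffBdiag B) j k = if j == k then 0 else submxblock B j k.
Proof.
rewrite /OffBdiag /Bdiag submxblockB mxblockK.
case: eqP => [jk|_]; last by rewrite subr0.
(* The diagonal block is cast by [conform_mx], which becomes the identity once [j] and [k] are
   identified. *)
by case: _ / jk; rewrite conform_mx_id subrr.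
Qed.

Lemma submxblock_sylvester s (tau : 'I_s -> nat)
    (B : 'M[R]_(\sum_(j < s) tau j)) (G : forall j : 'I_s, 'M[R]_(tau j)) j k :
  submxblock (B *m \mxdiag_i G i - (\mxdiag_i G i)^T *m B) j k =
    submxblock B j k *m G k - (G j)^T *m submxblock B j k.
Proof.
rewrite tr_mxdiag -[in LHS](submxblockK B) mul_mxblock_mxdiag mul_mxdiag_mxblock.
by rewrite submxblockB !mxblockK.
Qed.

(** Squared norms add over blocks, so it suffices to compare block by block: a diagonal block
    contributes 0 on the left, and the others are governed by [sep2]. *)
Lemma sep_OffBdiag_le s (tau : 'I_s -> nat)
    (B : 'M[R]_(\sum_(j < s) tau j)) (G : forall j : 'I_s, 'M[R]_(tau j)) :
  0 <= sep G ->
  sep G ^+ 2 * frobenius_norm (OffBdiag B) ^+ 2 <=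
    frobenius_norm (B *m \mxdiag_i G i - (\mxdiag_i G i)^T *m B) ^+ 2.
Proof.
move=> sepG; rewrite !sqr_frobenius_norm_blocks mulr_sumr.
apply: ler_sum => j _; rewrite mulr_sumr; apply: ler_sum => k _.
rewrite submxblock_OffBdiag submxblock_sylvester -exprMn.
have [_|jk] := eqVneq.
  by rewrite frobenius_norm0 mulr0 expr0n sqr_ge0.
rewrite ler_sqr ?nnegrE ?mulr_ge0 ?frobenius_norm_ge0 //.
rewrite -[leRHS]frobenius_normN opprB; apply: le_trans (sep2_le _ _ _).
by rewrite ler_wpM2r ?frobenius_norm_ge0 // sep_le_sep2.
Qed.

End Sylvester.

Theorem theorem3p1 (R : realType) (m s : nat) (tau : 'I_s -> nat)
    (A : 'I_m -> 'M[R]_(\sum_(j < s) tau j))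
    (Z W : 'M[R]_(\sum_(j < s) tau j)) (delta : R)
    (G : forall j : 'I_s, 'M[R]_(tau j)) :
  (1 < s)%N ->
  (forall j : 'I_s, (0 < tau j)%N) ->
  0 <= delta ->
  \sum_(i < m) frobenius_norm (A i *m Z - Z^T *m A i) ^+ 2
    <= delta ^+ 2 * frobenius_norm Z ^+ 2 ->
  W \in unitmx ->
  Z = W *m (\mxdiag_(j < s) G j) *m invmx W ->
  (forall j k : 'I_s, j != k -> spectrum (G j) `&` spectrum (G k) = set0) ->
  Bdiag (W^T *m W) = 1%:M ->
  offdiag_cost A W
    <= delta ^+ 2 * frobenius_norm Z ^+ 2 * spectral_norm W ^+ 4 / sep G ^+ 2.
Proof.
move=> s1 tau0 _ AZ Wu ZE disj _.
have sep0 : 0 < sep G.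
  by apply: sep_gt0 => // j k jk; apply: sep2_tr_gt0 => //; exact: disj.
rewrite ler_pdivlMr ?exprn_gt0 // mulrC /offdiag_cost mulr_sumr.
rewrite mulrC; apply: le_trans (ler_wpM2l (exprn_ge0 4 (spectral_norm_ge0 W)) AZ).
rewrite mulr_sumr; apply: ler_sum => i _.
apply: le_trans (sep_OffBdiag_le _ (ltW sep0)) _.
(* From [Z W = W G] and its transpose [W^T Z^T = G^T W^T], where [G] is the block diagonal
   matrix. *)
have -> : W^T *m A i *m W *m (\mxdiag_j G j)
    - (\mxdiag_j G j)^T *m (W^T *m A i *m W)
    = W^T *m (A i *m Z - Z^T *m A i) *m W.
  rewrite ZE mulmxBr mulmxBl !trmx_mul !mulmxA mulmxKV //.
  by rewrite -[W^T *m (invmx W)^T]trmx_mul mulVmx // trmx1 mul1mx.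
(* The fourth power is the square of the factor [spectral_norm W ^+ 2] of a congruence. *)
rewrite (exprM _ 2 2) -exprMn ler_sqr ?nnegrE ?mulr_ge0 ?exprn_ge0 ?spectral_norm_ge0
  ?frobenius_norm_ge0 //.
exact: frobenius_norm_congruence.
Qed.
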